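(* Let $\alpha\in(0,1)$ and let $v\in C^1(0,+\infty)$. If there exist two constants $C>0$ and $\beta\in\left(\frac{\alpha-1}{\alpha},2\right)$ such that $|v'(t)|\le Ct^{-\beta}$ for all $t>0$, then $S_\alpha v$ is in $C^1(0,+\infty)$ and its derivative equals $$\frac{d}{dt}S_\alpha v(t)=\alpha t^{-1}S_\alpha(zv'(z))(t),\qquad t>0.$$
   Context: For $\alpha\in(0,1)$, $\sigma_\alpha$ is the $\alpha$-stable subordinator with $\mathbb{E}[e^{-\lambda\sigma_\alpha(t)}]=e^{-t\lambda^\alpha}$, $E_\alpha(t)=\inf\{y>0:\sigma_\alpha(y)>t\}$ is its inverse, $g_\alpha$ is the probability density function of $\sigma_\alpha(1)$ and $f_\alpha(s,t)$ is the probability density function (in $s>0$) of $E_\alpha(t)$, $t>0$; it satisfies $f_\alpha(s,t)=\frac{t}{\alpha}s^{-1-\frac1\alpha}g_\alpha(ts^{-\frac1\alpha})$. The subordination operator is $S_\alpha v(t)=\mathbb{E}[v(E_\alpha(t))]=\int_0^{+\infty}v(s)f_\alpha(s,t)\,ds$, and $S_\alpha(zv'(z))$ denotes $S_\alpha$ applied to the function $z\mapsto zv'(z)$. *)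

(* Defs.v *)
From HB Require Import structures.
From mathcomp Require Import all_boot all_order all_algebra.
From mathcomp Require Import all_classical all_reals all_analysis.

Set Implicit Arguments.
Unset Strict Implicit.
Unset Printing Implicit Defensive.

Import Order.TTheory GRing.Theory Num.Theory.
Import numFieldNormedType.Exports.

Local Open Scope ring_scope.
Local Open Scope classical_set_scope.

(* A real function on (0, +oo) is encoded by a total function R -> R whose
   values on (-oo, 0] are irrelevant. *)
Definition C1_pos (R : realType) (v : R -> R) : Prop :=
  (forall t, 0 < t -> derivable v t 1) /\
  (forall t, 0 < t -> {for t, continuous (derive1 v)}).

Section Subordinator.
Context {R : realType} {d : measure_display} {T : measurableType d}.
Variable P : probability T R.

(* The process is indexed by times t >= 0; its values at negative indices are
   unconstrained. *)
Definition increment (sigma : R -> {RV P >-> R}) (s t : R) : T -> R :=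
  fun w => sigma t w - sigma s w.

(* Independence over subfamilies of the increments is the case where some of
   the B i are setT. *)
Definition independent_increments (sigma : R -> {RV P >-> R}) : Prop :=
  forall (n : nat) (t : nat -> R) (B : nat -> set R),
    0 <= t 0%N -> (forall i, (i < n)%N -> t i <= t i.+1) ->
    (forall i, (i < n)%N -> measurable (B i)) ->
    P (\bigcap_(i < n) (increment sigma (t i) (t i.+1) @^-1` B i)) =
    (\prod_(i < n) P (increment sigma (t i) (t i.+1) @^-1` B i))%E.

Definition stationary_increments (sigma : R -> {RV P >-> R}) : Prop :=
  forall (s h : R) (B : set R), 0 <= s -> 0 <= h -> measurable B ->
    P (increment sigma s (s + h) @^-1` B) = P (sigma h @^-1` B).

(* Left limits are not mentioned: they exist for monotone paths. *)
Record is_subordinator (sigma : R -> {RV P >-> R}) : Prop := {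
  subordinator0 : forall w, sigma 0 w = 0;
  subordinator_nondecreasing : forall w s t,
    0 <= s -> s <= t -> sigma s w <= sigma t w;
  subordinator_right_continuous : forall w t,
    0 <= t -> sigma s w @[s --> t^'+] --> sigma t w;
  subordinator_independent : independent_increments sigma;
  subordinator_stationary : stationary_increments sigma }.

Definition is_stable_subordinator (alpha : R) (sigma : R -> {RV P >-> R}) :
    Prop :=
  is_subordinator sigma /\
  forall t lambda : R, 0 <= t -> 0 <= lambda ->
    ('E_P[fun w => expR (- (lambda * sigma t w))] =
     (expR (- (t * lambda `^ alpha)))%:E)%E.

(* [inf] of an empty or unbounded set is 0 by convention.  The set below is
   empty only when the path stays below t forever, which has probability 0 for
   a stable subordinator. *)
Definition inverse_process (sigma : R -> {RV P >-> R}) (t : R) : T -> R :=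
  fun w => inf [set y | 0 < y /\ t < sigma y w].

Definition subordinable_at (sigma : R -> {RV P >-> R}) (v : R -> R) (t : R) :
    Prop :=
  P.-integrable setT (EFin \o (v \o inverse_process sigma t)).

(* [fine] sends infinite values to 0; the value is the mathematical one when
   [subordinable_at sigma v t] holds. *)
Definition subordination (sigma : R -> {RV P >-> R}) (v : R -> R) (t : R) : R :=
  fine ('E_P[v \o inverse_process sigma t])%E.

End Subordinator.

(* Main.v *)
Require Import Defs.
From HB Require Import structures.
From mathcomp Require Import all_boot all_order all_algebra.
From mathcomp Require Import all_classical all_reals all_analysis.
From mathcomp Require Import measurable_realfun ring lra.

Import Order.TTheory GRing.Theory Num.Theory.
Import numFieldNormedType.Exports.

Local Open Scope ring_scope.
Local Open Scope classical_set_scope.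

Set Implicit Arguments.
Unset Strict Implicit.
Unset Printing Implicit Defensive.

(** The inverse [E t] has the law of [t ^ alpha * Y], where [Y] is
    [sigma 1 ^ (- alpha)].  This follows from the duality
    [E t < s => t < sigma s => E t <= s], up to a null set, and from the
    self-similarity [sigma s ~ s ^ (1 / alpha) * sigma 1] in law.  Hence
    [S v t] is the expectation of [v (t ^ alpha * Y)], where [t] occurs in
    the argument of [v] only.  The chain rule gives
    [d/dt v (t ^ alpha * Y) = alpha / t * g (t ^ alpha * Y)] with
    [g z = z * v' z], and the theorem is differentiation under the expectation,
    the continuity of the derivative being continuity under the expectation.

    Self-similarity compares Laplace transforms, so it needs their injectivity
    ([laplace_tail_unique]).  For [X >= 0] and [u = exp (- l X)] the polynomials
    [(1 - u ^ n) ^ (n 2 ^ n)] converge boundedly to the indicator of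
    [u < 1 / 2], that is of [X > ln 2 / l]; the expectation of each of them is a
    finite combination of values of the Laplace transform, which therefore
    determines [P (X > c)] for every [c > 0].

    Domination needs [E (Y ^ r)] finite for [r > -1], that is
    [E (sigma 1 ^ p)] finite for [p < alpha] ([stable_moment]).  Markov's
    inequality bounds [P (sigma 1 >= x)] by a multiple of [x ^ (- alpha)], and
    [P (1 / sigma 1 >= x)] by [e * exp (- x ^ alpha)]; a dyadic sum turns tail
    bounds into moments ([integrable_powR_tail]).  The bound
    [|v' t| <= C t ^ (- beta)] with [beta < 2] integrates to a bound of [v] by
    powers with exponents larger than [-1] ([moderate_growth_derive1]), and
    [z * v' z] is bounded by [C z ^ (1 - beta)], so both integrands are
    dominated, locally uniformly in [t]. *)

(** * Level sets and exponentials of measurable functions *)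

Lemma measurable_gt_set (R : realType) (d : measure_display)
    (T : measurableType d) (X : T -> R) (c : R) :
  measurable_fun setT X -> measurable [set w | c < X w].
Proof.
move=> mX; rewrite (_ : [set w | _] = X @^-1` `]c, +oo[); last first.
  by apply/seteqP; split=> w /=; rewrite in_itv/= andbT.
by rewrite -[X in measurable X]setTI; exact: mX.
Qed.

Lemma measurable_ge_set (R : realType) (d : measure_display)
    (T : measurableType d) (X : T -> R) (c : R) :
  measurable_fun setT X -> measurable [set w | c <= X w].
Proof.
move=> mX; rewrite (_ : [set w | _] = X @^-1` `[c, +oo[); last first.
  by apply/seteqP; split=> w /=; rewrite in_itv/= andbT.
by rewrite -[X in measurable X]setTI; exact: mX.
Qed.

Lemma measurable_le_set (R : realType) (d : measure_display)
    (T : measurableType d) (X : T -> R) (c : R) :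
  measurable_fun setT X -> measurable [set w | X w <= c].
Proof.
move=> mX; rewrite (_ : [set w | _] = ~` [set w | c < X w]).
  by apply: measurableC; exact: measurable_gt_set.
by apply/seteqP; split => w /=; rewrite leNgt => /negP.
Qed.

Lemma measurable_expRN (R : realType) (d : measure_display)
    (T : measurableType d) (X : T -> R) (l : R) :
  measurable_fun setT X -> measurable_fun setT (fun w => expR (- (l * X w))).
Proof.
move=> mX; apply: (measurableT_comp (f := expR)) => //.
by apply: measurableT_comp => //; exact: measurable_funM.
Qed.

(** * A polynomial approximation of a threshold *)

Lemma bernoulli_ineq (R : realFieldType) (x : R) (n : nat) :
  -1 <= x -> 1 + n%:R * x <= (1 + x) ^+ n.
Proof.
move=> x1; elim: n => [|n IH]; first by rewrite mul0r addr0 expr0.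
rewrite exprS (le_trans _ (ler_wpM2l _ IH))//; last lra.
rewrite -natr1 -subr_ge0.
have -> : (1 + x) * (1 + n%:R * x) - (1 + (n%:R + 1) * x) = n%:R * x ^+ 2.
  by ring.
by rewrite mulr_ge0// sqr_ge0.
Qed.

Lemma cvg_mulrn_expr (R : realType) (q : R) :
  0 <= q < 1 -> n%:R * q ^+ n @[n --> \oo] --> (0 : R).
Proof.
move=> /andP[q0 q1].
have [->|qn0] := eqVneq q 0.
  apply: cvg_near_cst; near=> n.
  by rewrite expr0n gt_eqF ?mulr0//; near: n; exact: nbhs_infty_gt.
have {qn0 q0} q0 : 0 < q by rewrite lt_neqAle eq_sym qn0.
(* Writing q = s ^ 2, the factor n s ^ n stays bounded by Bernoulli's
   inequality for 1 / s, and the other factor s ^ n tends to 0. *)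
pose s := Num.sqrt q.
have s0 : 0 < s by rewrite sqrtr_gt0.
have s1 : s < 1 by rewrite -sqrtr1 ltr_sqrt.
have qE : q = s * s by rewrite -expr2 sqr_sqrtr// ltW.
have sV : 0 < s^-1 - 1 by rewrite subr_gt0 invf_gt1.
apply: (@squeeze_cvgr _ _ _ _ (cst 0) (geometric (s^-1 - 1)^-1 s)).
- apply: nearW => n /=; have sn0 := exprn_gt0 n s0.
  rewrite qE exprMn mulrA; apply/andP; split.
    by rewrite !mulr_ge0// ltW.
  rewrite ler_pM2r// -ler_pdivlMr// mulrC ler_pdivlMr//.
  rewrite mulrC -[in leRHS]exprVn.
  have : 1 + n%:R * (s^-1 - 1) <= (1 + (s^-1 - 1)) ^+ n.
    by apply: bernoulli_ineq; lra.
  by rewrite [1 + (s^-1 - 1)]addrC subrK mulrC; lra.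
- exact: cvg_cst.
- by apply: cvg_geometric; rewrite ger0_norm// ltW.
Unshelve. all: by end_near. Qed.

(** The exponent [n * 2 ^ n], rather than [2 ^ n], makes the limit a genuine
    indicator, with value [0] at the threshold: at [u = 1 / 2] the sequence
    [(1 - u ^ n) ^ (2 ^ n)] would tend to [exp (- 1)].  Below the threshold the
    extra factor is harmless because [n (2 u) ^ n] still tends to [0]. *)
Lemma cvg_threshold (R : realType) (u : R) : 0 <= u <= 1 ->
  (1 - u ^+ n) ^+ (n * 2 ^ n) @[n --> \oo] --> ((u < 2^-1)%R%:R : R).
Proof.
move=> /andP[u0 u1].
have un0 n : 0 <= u ^+ n <= 1 by rewrite exprn_ge0// exprn_ile1.
have pn0 n : 0 <= (1 - u ^+ n) ^+ (n * 2 ^ n) <= 1.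
  by have /andP[? ?] := un0 n; rewrite exprn_ge0 ?exprn_ile1//; lra.
have [u2|u2] := ltP u 2^-1.
  apply: (@squeeze_cvgr _ _ _ _ (fun n => 1 - n%:R * (2 * u) ^+ n) (cst 1)).
  - apply: nearW => n; have /andP[_ ->] := pn0 n; rewrite andbT.
    have := @bernoulli_ineq _ (- u ^+ n) (n * 2 ^ n).
    rewrite exprMn natrM natrX mulrN mulrA; apply.
    by have := un0 n; lra.
  - rewrite -[X in _ --> X]subr0; apply: cvgB; first exact: cvg_cst.
    by apply: cvg_mulrn_expr; lra.
  - exact: cvg_cst.
apply: (@squeeze_cvgr _ _ _ _ (cst 0) (fun n => expR (-1) ^+ n)).
- apply: nearW => n /=; have /andP[-> _] /= := pn0 n.
  apply: (@le_trans _ _ (expR (- u ^+ n) ^+ (n * 2 ^ n))).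
    rewrite lerXn2r ?nnegrE ?expR_ge0 ?expR_ge1Dx//.
    by have := un0 n; lra.
  rewrite -!expRM_natl ler_expR natrM natrX mulrN mulrN1 lerN2.
  rewrite -mulrA -exprMn ler_peMr// exprn_ege1//; lra.
- exact: cvg_cst.
- by apply: cvg_expr; rewrite ger0_norm ?expR_ge0// expR_lt1; lra.
Qed.

(** * The Laplace transform determines the tails *)

(** The expectation of [(1 - u ^ n) ^ (n 2 ^ n)] for [u = exp (- (ln 2 / c) X)],
    expanded by the binomial formula, when [phi] is the Laplace transform of
    [X]. *)
Definition laplace_tail (R : realType) (phi : R -> R) (c : R) (n : nat) : R :=
  \sum_(k < (n * 2 ^ n).+1)
    ((-1) ^+ k * phi (ln 2 / c * (n * k)%:R)) *+ 'C(n * 2 ^ n, k).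

(** An inversion formula: the exponent rate [ln 2 / c] places the threshold
    [u = 1 / 2] exactly at [X = c]. *)
Lemma cvg_laplace_tail (R : realType) (d : measure_display)
    (T : measurableType d) (P : probability T R) (X : T -> R) (phi : R -> R)
    (c : R) :
  measurable_fun setT X -> (forall w, 0 <= X w) -> 0 < c ->
  (forall l : R, 0 <= l ->
    ('E_P[fun w => expR (- (l * X w))] = (phi l)%:E)%E) ->
  (laplace_tail phi c n)%:E @[n --> \oo] --> P [set w | c < X w].
Proof.
move=> mX X0 c0 EX.
pose l := ln 2 / c.
have ln20 : 0 < ln 2 :> R by rewrite ln_gt0// ltr1n.
have l0 : 0 < l by rewrite divr_gt0.
pose u w := expR (- (l * X w)).
have u01 w : 0 <= u w <= 1.
  by rewrite expR_ge0 -expR0 ler_expR oppr_le0 mulr_ge0// ltW.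
have me a : measurable_fun setT (fun w => expR (- (a * X w))).
  apply: (measurableT_comp (f := expR)) => //.
  by apply: measurableT_comp => //; exact: measurable_funM.
have ie a : 0 <= a ->
    P.-integrable setT (EFin \o (fun w => expR (- (a * X w)))).
  move=> a0; apply: (@le_integrable _ _ _ _ _ _ _ (EFin \o cst 1)) => //.
  - exact/measurable_EFinP.
  - move=> w _ /=; rewrite lee_fin normr1 ger0_norm ?expR_ge0//.
    by rewrite -expR0 ler_expR oppr_le0 mulr_ge0.
  - exact: finite_measure_integrable_cst.
have mcX := measurable_gt_set c mX.
(* Bounded convergence of the threshold polynomials, dominated by 1. *)
have [|||||_ _] := @dominated_convergence _ _ _ P setT measurableT
  (fun n w => ((1 - u w ^+ n) ^+ (n * 2 ^ n))%:E)
  (fun w => (\1_[set w | c < X w] w)%:E) (EFin \o cst 1).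
- move=> n; apply/measurable_EFinP; apply: measurable_funX.
  apply: measurable_funB => //; apply: measurable_funX; exact: me.
- by apply/measurable_EFinP.
- apply: aeW => w _; apply: cvg_EFin; first exact: nearW.
  have E : (w \in [set w | c < X w]) = (u w < 2^-1).
    have -> : (u w < 2^-1) = (c < X w).
      rewrite /u -[2^-1]lnK ?posrE ?invr_gt0// ltr_expR lnV ?posrE// ltrN2.
      by rewrite /l mulrAC ltr_pdivlMr// ltr_pM2l.
    by apply/idP/idP; rewrite in_setE.
  by rewrite indicE E; exact: cvg_threshold.
- exact: finite_measure_integrable_cst.
- apply: aeW => w n _ /=; rewrite lee_fin ger0_norm; last first.
    by rewrite exprn_ge0// subr_ge0 exprn_ile1//; case/andP: (u01 w).
  have /andP[u0 u1] := u01 w.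
  rewrite exprn_ile1// ?subr_ge0 ?exprn_ile1//.
  by rewrite gerBl exprn_ge0.
rewrite integral_indic// setIT.
rewrite (_ : [sequence _]_n = fun n => (laplace_tail phi c n)%:E)//.
apply/funext => n /=.
pose a (k : 'I_(n * 2 ^ n).+1) : R := (-1) ^+ k *+ 'C(n * 2 ^ n, k).
transitivity (\int[P]_w (\sum_(k < (n * 2 ^ n).+1)
    ((a k)%:E * (expR (- (l * (n * k)%:R * X w)))%:E)))%E.
  apply: eq_integral => w _; under eq_bigr do rewrite -EFinM.
  rewrite sumEFin exprBn; congr (_%:E); apply: eq_bigr => k _.
  rewrite expr1n mulr1 -mulrnAl; congr (_ * _).
  rewrite -exprM -expRM_natl; congr (expR _).
  by rewrite mulrN; congr (- _); ring.
have lnk0 k : 0 <= l * (n * k)%:R by rewrite mulr_ge0// ltW.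
rewrite integral_sum//; last by move=> k; apply: integrableZl => //; exact: ie.
rewrite /laplace_tail -sumEFin; apply: eq_bigr => k _.
rewrite integralZl//; last exact: ie.
have := EX _ (lnk0 k); rewrite unlock => ->.
by rewrite -EFinM /a -mulrnAl.
Qed.

Lemma laplace_tail_unique (R : realType) (d1 d2 : measure_display)
    (T1 : measurableType d1) (T2 : measurableType d2)
    (P1 : probability T1 R) (P2 : probability T2 R)
    (X1 : T1 -> R) (X2 : T2 -> R) (phi : R -> R) (c : R) :
  measurable_fun setT X1 -> (forall w, 0 <= X1 w) ->
  (forall l : R, 0 <= l ->
    ('E_P1[fun w => expR (- (l * X1 w))] = (phi l)%:E)%E) ->
  measurable_fun setT X2 -> (forall w, 0 <= X2 w) ->
  (forall l : R, 0 <= l ->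
    ('E_P2[fun w => expR (- (l * X2 w))] = (phi l)%:E)%E) ->
  0 < c -> P1 [set w | c < X1 w] = P2 [set w | c < X2 w].
Proof.
move=> mX1 X10 EX1 mX2 X20 EX2 c0.
apply: (cvg_unique _ (cvg_laplace_tail mX1 X10 c0 EX1)) => //.
exact: (cvg_laplace_tail mX2 X20 c0 EX2).
Qed.

(** * Moments from tail bounds *)

Lemma nneseries_geometric_lty (R : realType) (a q : R) :
  0 <= a -> 0 <= q < 1 -> (\sum_(0 <= n <oo) (a * q ^+ n)%:E < +oo)%E.
Proof.
move=> a0 /andP[q0 q1].
have q1' : `|q| < 1 by rewrite ger0_norm.
have h := @cvg_geometric_series R a q q1'.
have -> : (\sum_(0 <= n <oo) (a * q ^+ n)%:E = (a / (1 - q))%:E)%E.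
  apply: cvg_lim => //.
  rewrite (_ : (fun n => _) = EFin \o series (geometric a q)); last first.
    by apply/funext => n /=; rewrite sumEFin.
  by apply: cvg_EFin => //; exact: nearW.
exact: ltry.
Qed.

(** The dyadic form of the layer-cake formula: on [2 ^ n <= Y < 2 ^ (n + 1)] the
    power [Y ^ r] is at most [2 ^ (r (n + 1))], this event has probability
    [O (2 ^ (- s n))], and the resulting series is geometric with ratio
    [2 ^ (r - s) < 1]. *)
Lemma integrable_powR_tail (R : realType) (d : measure_display)
    (T : measurableType d) (P : probability T R) (Y : T -> R) (K r s : R) :
  measurable_fun setT Y -> (forall w, 0 <= Y w) -> 0 <= r < s ->
  (forall n : nat,
    (P [set w | (2 ^+ n <= Y w)%R] <= (K * (2 `^ (- s)) ^+ n)%:E)%E) ->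
  P.-integrable setT (EFin \o (fun w => Y w `^ r)).
Proof.
move=> mY Y0 /andP[r0 rs] PY.
have K0 : 0 <= K.
  have := PY 0%N; rewrite expr0 mulr1 -lee_fin; apply: le_trans.
  exact: measure_ge0.
have mA n : measurable [set w | (2 ^+ n <= Y w)%R].
  rewrite (_ : [set w | _] = Y @^-1` `[2 ^+ n, +oo[); last first.
    by apply/seteqP; split=> w /=; rewrite in_itv/= andbT.
  by rewrite -[X in measurable X]setTI; exact: mY.
pose f (n : nat) w : \bar R :=
  ((2 `^ r) ^+ n.+1 * \1_[set w | (2 ^+ n <= Y w)%R] w)%:E.
have f0 n w : (0 <= f n w)%E.
  by rewrite lee_fin mulr_ge0// exprn_ge0// powR_ge0.
have mf n : measurable_fun setT (f n).
  by apply/measurable_EFinP; apply: measurable_funM.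
have mYr : measurable_fun setT (fun w => Y w `^ r).
  by apply: (measurableT_comp (measurable_powR r)).
apply/integrableP; split; first exact/measurable_EFinP.
apply: (@le_lt_trans _ _ (\int[P]_w (1 + \sum_(0 <= n <oo) f n w))%E).
  apply: ge0_le_integral => //.
  - by apply: measurableT_comp => //; exact/measurable_EFinP.
  - apply: emeasurable_funD => //; exact: ge0_emeasurable_sum.
  - move=> w _ /=; rewrite ger0_norm ?powR_ge0//.
    have [Y1|Y1] := leP (Y w) 1.
      rewrite (@le_trans _ _ 1%E)//; last by rewrite leeDl// nneseries_ge0.
      rewrite lee_fin (_ : 1 = 1 `^ r); last by rewrite powR1.
      by rewrite ge0_ler_powR// nnegrE.
    have : exists n : nat, 2 ^+ n <= Y w < 2 ^+ n.+1.
      have ex : exists n, Y w < 2 ^+ n.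
        by exists (Num.bound (Y w)); exact: upper_nthrootP.
      case: (ex_minnP ex) => -[|n] Yn nmin.
        by move: Yn; rewrite expr0; lra.
      by exists n; rewrite Yn andbT leNgt; apply/negP => /nmin; rewrite ltnn.
    move=> [n /andP[n1 n2]].
    rewrite (@le_trans _ _ (f n w))//; last first.
      rewrite (nneseriesD1 (n := n))// addeA (addeC 1%E) -addeA leeDl//.
      by rewrite adde_ge0// nneseries_ge0.
    rewrite lee_fin indicE mem_set//= mulr1 -powR_mulrn ?powR_ge0//.
    rewrite powRAC ge0_ler_powR ?nnegrE ?powR_mulrn//.
    exact: ltW.
rewrite ge0_integralD//; last 2 first.
- by move=> w _; rewrite nneseries_ge0.
- exact: ge0_emeasurable_sum.
rewrite lte_add_pinfty//.
  by rewrite (integral_cst _ _ 1)// mul1e [X in (X < _)%E]probability_setT ltry.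
rewrite integral_nneseries//.
apply: (@le_lt_trans _ _
  (\sum_(0 <= n <oo) ((2 `^ r * K) * (2 `^ (r - s)) ^+ n)%:E)%E).
  apply: lee_nneseries => [n _ _|n _]; first exact: integral_ge0.
  rewrite /f; under eq_integral do rewrite EFinM.
  rewrite ge0_integralZl//; last exact/measurable_EFinP.
  rewrite integral_indic// setIT.
  apply: (le_trans (lee_wpmul2l _ (PY n))).
    by rewrite lee_fin exprn_ge0 ?powR_ge0.
  rewrite -EFinM lee_fin powRD; last by rewrite pnatr_eq0 implybT.
  rewrite exprS exprMn le_eqVlt; apply/orP; left; apply/eqP; ring.
apply: nneseries_geometric_lty; first by rewrite mulr_ge0 ?powR_ge0.
rewrite powR_ge0/= /powR pnatr_eq0/= -[ltRHS]expR0 ltr_expR pmulr_llt0.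
  lra.
by rewrite ln_gt0// ltr1n.
Qed.

(** * Moments of one-sided stable variables *)

(** Markov's inequality for [exp (- l X)]. *)
Lemma laplace_markov (R : realType) (d : measure_display)
    (T : measurableType d) (P : probability T R) (X : T -> R) (l a : R) :
  measurable_fun setT X -> 0 <= l ->
  (P [set w | (X w <= a)%R] <=
   (expR (l * a))%:E * 'E_P[fun w => expR (- (l * X w))])%E.
Proof.
move=> mX l0; have mA := measurable_le_set a mX.
have : (\int[P]_w ((\1_[set w | (X w <= a)%R] w)%:E) <=
   \int[P]_w ((expR (l * a))%:E * (expR (- (l * X w)))%:E))%E.
  apply: ge0_le_integral => //.
  - exact/measurable_EFinP.
  - by apply: measurable_funeM; apply/measurable_EFinP; exact: measurable_expRN.
  - move=> w _; rewrite -EFinM lee_fin indicE -expRD.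
    have [Xa|Xa] := boolP (w \in _); last by rewrite expR_ge0.
    rewrite in_setE/= in Xa.
    by rewrite -[leLHS]expR0 ler_expR subr_ge0 ler_wpM2l.
rewrite integral_indic// setIT ge0_integralZl//; last first.
  by apply/measurable_EFinP; exact: measurable_expRN.
by rewrite unlock.
Qed.

Section one_sided_stable.
Context (R : realType) (d : measure_display) (T : measurableType d).
Variables (P : probability T R) (alpha : R) (S : T -> R).
Hypotheses (alpha0 : 0 < alpha) (mS : measurable_fun setT S).
Hypothesis S0 : forall w, 0 < S w.
Hypothesis laplaceS : forall l : R, 0 <= l ->
  ('E_P[fun w => expR (- (l * S w))] = (expR (- (l `^ alpha)))%:E)%E.

(** Markov's inequality for [1 - exp (- S / x)], whose expectation is
    [1 - exp (- x ^ (- alpha)) <= x ^ (- alpha)] and which is at least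
    [1 - exp (- 1)] when [S >= x]. *)
Lemma stable_upper_tail (x : R) : 0 < x ->
  (P [set w | (x <= S w)%R] <= ((1 - expR (-1))^-1 * x `^ (- alpha))%:E)%E.
Proof.
move=> x0.
have mA := measurable_ge_set x mS.
have e1 : expR (-1) < 1 :> R by rewrite -[ltRHS]expR0 ltr_expR; lra.
have := laplaceS (ltW (divr_gt0 (@ltr01 R) x0)).
rewrite unlock => El.
have : (\int[P]_w ((1 - expR (-1))%:E * (\1_[set w | (x <= S w)%R] w)%:E +
   (expR (- (1 / x * S w)))%:E) <= \int[P]_w (cst 1 w))%E.
  apply: ge0_le_integral => //.
  - move=> w _; apply: adde_ge0; last by rewrite lee_fin expR_ge0.
    by rewrite -EFinM lee_fin mulr_ge0//; lra.
  - apply: emeasurable_funD; last first.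
      by apply/measurable_EFinP; exact: measurable_expRN.
    by apply: measurable_funeM; exact/measurable_EFinP.
  - move=> w _; rewrite -EFinM -EFinD lee_fin indicE.
    have [xS|xS] := boolP (w \in _).
      rewrite in_setE/= in xS; rewrite mulr1.
      have : expR (- (1 / x * S w)) <= expR (- 1).
        by rewrite ler_expR lerN2 mulrC mulrA mulr1 ler_pdivlMr// mul1r.
      lra.
    rewrite mulr0 add0r -expR0 ler_expR oppr_le0 mulr_ge0 1?ltW//.
    by rewrite divr_gt0.
rewrite integral_cst// mul1e [X in (_ <= X)%E -> _]probability_setT.
rewrite ge0_integralD//; last 2 first.
- by apply: measurable_funeM; exact/measurable_EFinP.
- by apply/measurable_EFinP; exact: measurable_expRN.
rewrite El ge0_integralZl//; last exact/measurable_EFinP.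
rewrite integral_indic// setIT.
have [p pE] : exists p, P [set w | (x <= S w)%R] = p%:E.
  by exists (fine (P [set w | (x <= S w)%R])); rewrite fineK// fin_num_measure.
rewrite pE lee_fin => h.
have {h} : ((1 - expR (-1))%:E * p%:E + (expR (- (1 / x) `^ alpha))%:E <= 1)%E.
  by rewrite -pE; exact: h.
rewrite -EFinM -EFinD lee_fin div1r.
rewrite (mulrC _^-1) ler_pdivlMr; last lra.
have := expR_ge1Dx (- (x^-1 `^ alpha)).
have -> : x^-1 `^ alpha = x `^ (- alpha).
  by rewrite -powR_inv1 ?(ltW x0)// -powRrM mulN1r.
lra.
Qed.

Lemma stable_lower_tail (x : R) : 0 < x ->
  (P [set w | (x <= (S w)^-1)%R] <= (expR 1 * expR (- (x `^ alpha)))%:E)%E.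
Proof.
move=> x0; rewrite (_ : [set w | _] = [set w | S w <= x^-1]); last first.
  by apply/seteqP; split => w /= h;
    rewrite -[leLHS]invrK lef_pV2 ?posrE ?invr_gt0.
have := @laplace_markov _ _ _ P _ _ x^-1 mS (ltW x0).
by rewrite laplaceS ?(ltW x0)// mulfV ?gt_eqF.
Qed.

Let expr_powR (n : nat) (a : R) : (2 ^+ n) `^ a = (2 `^ a) ^+ n :> R.
Proof. by rewrite -!powR_mulrn ?powR_ge0// powRAC. Qed.

(** Positive moments come from the polynomial upper tail.  The lower tail decays
    faster than every power, so [1 / S] has all positive moments. *)
Lemma stable_moment (p : R) : p < alpha ->
  P.-integrable setT (EFin \o (fun w => S w `^ p)).
Proof.
move=> pa; have [p0|p0] := leP 0 p.
  apply: (@integrable_powR_tail _ _ _ _ _ (1 - expR (-1))^-1 p alpha) => //.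
  - by move=> w; exact: ltW.
  - by rewrite p0.
  - move=> n; have := @stable_upper_tail (2 ^+ n) (exprn_gt0 n (ltr0n R 2)).
    by rewrite expr_powR.
(* The factorial bound exp (- y) <= (m + 1)! / y ^ (m + 1), with y = x ^ alpha,
   beats the exponent - p as soon as alpha (m + 1) > - p. *)
pose m := Num.bound (- p / alpha).
pose s := alpha * m.+1%:R.
have mS' : measurable_fun setT (fun w => (S w)^-1).
  rewrite (_ : (fun w => _) = (fun w => S w `^ (-1))).
    exact: (measurableT_comp (measurable_powR (-1))).
  by apply/funext => w; rewrite powR_inv1// ltW.
rewrite (_ : (fun w => _) = (fun w => (S w)^-1 `^ (- p))); last first.
  apply/funext => w; rewrite -powR_inv1 ?(ltW (S0 w))// -powRrM.
  by rewrite mulN1r opprK.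
apply: (@integrable_powR_tail _ _ _ _ _ (expR 1 * (m.+1)`!%:R) (- p) s) => //.
- by move=> w; rewrite invr_ge0 ltW.
- rewrite /s oppr_ge0 (ltW p0)/= mulrC -ltr_pdivrMr//.
  rewrite (lt_trans (archi_boundP _))// ?ltr_nat//.
  by rewrite divr_ge0// ?ltW// oppr_gt0.
- move=> n; have x0 := exprn_gt0 n (ltr0n R 2).
  apply: (le_trans (@stable_lower_tail (2 ^+ n) x0)).
  rewrite lee_fin -mulrA ler_pM2l ?expR_gt0//.
  have y0 : 0 < (2 ^+ n : R) `^ alpha by rewrite powR_gt0.
  have := @expR_ge1Dxn _ _ m (ltW y0).
  move: y0; set y := _ `^ alpha => y0 ye.
  have -> : (2 `^ (- s)) ^+ n = (y ^+ m.+1)^-1.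
    rewrite powRN exprVn; congr (_^-1).
    by rewrite /s powRrM powR_mulrn ?powR_ge0// /y expr_powR exprAC.
  have f0 : 0 < (m.+1)`!%:R :> R by rewrite ltr0n fact_gt0.
  have z0 : 0 < y ^+ m.+1 / (m.+1)`!%:R by rewrite divr_gt0// exprn_gt0.
  rewrite expRN -[leRHS]invrK lef_pV2 ?posrE ?expR_gt0//; last first.
    by rewrite invr_gt0 divr_gt0// exprn_gt0.
  by rewrite invf_div; apply: le_trans ye; rewrite lerDr.
Qed.
End one_sided_stable.

(** * Equality in law *)

Section equality_in_law.
Context (R : realType) (d : measure_display) (T : measurableType d).
Variables (P : probability T R) (X1 X2 : {RV P >-> R}).

Lemma ccdfE (X : {RV P >-> R}) (r : R) : ccdf X r = P [set w | r < X w].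
Proof.
by congr (P _); apply/seteqP; split => w; rewrite /= in_itv/= ?andbT.
Qed.

(** Right continuity of tails removes the loss between strict and large
    inequalities when two laws are compared through inclusions of events. *)
Lemma ccdf_le_gt (s : R) :
  (forall r, s < r -> (ccdf X1 r <= ccdf X2 s)%E) ->
  (ccdf X1 s <= ccdf X2 s)%E.
Proof.
move=> h; have := @ccdf_right_continuous _ _ _ P X1 s.
apply: cvge_le; near=> r; apply: h; near: r; exact: nbhs_right_gt.
Unshelve. all: by end_near. Qed.

Hypothesis eq_ccdf : forall s, ccdf X1 s = ccdf X2 s.

(** The rays [`]r, +oo[] form a pi-system that generates the Borel sets. *)
Lemma eq_distribution (A : set R) : measurable A ->
  distribution P X1 A = distribution P X2 A.
Proof.
move=> mA.
have h := @measure_unique _ R _ (@RGenOInfty.G R)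
  (fun n : nat => `] (- n%:R), +oo[%classic) (RGenOInfty.measurableE R)
  _ _ _ (distribution P X1) (distribution P X2).
apply: h => //.
- move=> _ _ [x ->] [y ->]; exists (Num.max x y).
  apply/seteqP; split => z /=; rewrite !in_itv/= !andbT gt_max.
    by move=> [-> ->].
  by move=> /andP[-> ->].
- by move=> i; exists (- i%:R).
- rewrite -subTset => x _; exists (Num.bound `|- x|) => //=.
  by rewrite in_itv/= andbT ltrNl (le_lt_trans (ler_norm _))// archi_boundP.
- by move=> _ [x ->]; exact: eq_ccdf.
- by move=> k; rewrite (le_lt_trans (probability_le1 _ _))// ltry.
Qed.

Lemma eq_law_integrable (f : R -> R) : measurable_fun setT f ->
  P.-integrable setT (EFin \o (f \o X1)) ->
  P.-integrable setT (EFin \o (f \o X2)).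
Proof.
move=> mf /integrableP[_ f1]; apply/integrableP; split.
  by apply/measurable_EFinP; exact: measurableT_comp.
have mf' : measurable_fun setT (fun x => `|(f x)%:E|)%E.
  by apply: measurableT_comp => //; exact/measurable_EFinP.
have := @ge0_integral_distribution _ _ _ _ _ P X2 _ mf' (fun=> abse_ge0 _).
rewrite /comp/= => <-.
rewrite (eq_measure_integral (distribution P X1)) => [|A mA _]; last first.
  by apply/esym; exact: eq_distribution.
by have := @ge0_integral_distribution _ _ _ _ _ P X1 _ mf' (fun=> abse_ge0 _);
  rewrite /comp/= => ->.
Qed.

Lemma eq_law_expectation (f : R -> R) : measurable_fun setT f ->
  P.-integrable setT (EFin \o (f \o X1)) ->
  ('E_P[f \o X1] = 'E_P[f \o X2])%E.
Proof.
move=> mf i1; have i2 := eq_law_integrable mf i1.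
have mf' : measurable_fun setT (EFin \o f) by exact/measurable_EFinP.
rewrite unlock.
have := @integral_distribution _ _ _ _ _ P X1 _ mf' i1.
have := @integral_distribution _ _ _ _ _ P X2 _ mf' i2.
rewrite /comp/= => <- <-.
by apply: eq_measure_integral => A mA _; exact: eq_distribution.
Qed.

End equality_in_law.

(** * The inverse of a subordinator *)

Section inverse_of_subordinator.
Context (R : realType) (d : measure_display) (T : measurableType d).
Variables (P : probability T R) (sigma : R -> {RV P >-> R}).
Hypothesis sub_sigma : is_subordinator sigma.

Lemma subordinator_ge0 t w : 0 <= t -> 0 <= sigma t w.
Proof.
move=> t0; rewrite -(subordinator0 sub_sigma w).
exact: subordinator_nondecreasing.
Qed.

Let passage t w := [set y | 0 < y /\ t < sigma y w].

Lemma passage_upper t s u w : 0 < s -> t < sigma s w -> s <= u -> t < sigma u w.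
Proof.
move=> s0 ts su; apply: (lt_le_trans ts).
by apply: subordinator_nondecreasing => //; exact: ltW.
Qed.

Lemma inverse_process_ge0 t w : 0 <= inverse_process sigma t w.
Proof.
rewrite /inverse_process -/(passage t w).
have [->|ne] := eqVneq (passage t w) set0; first by rewrite inf0.
by apply: lb_le_inf; [exact/set0P|move=> y [/ltW]].
Qed.

Lemma inverse_process_le t s w : 0 < s -> t < sigma s w ->
  inverse_process sigma t w <= s.
Proof. by move=> s0 ts; apply: ge_inf => //; exists 0 => y [/ltW]. Qed.

(** The second alternative is the infimum of the empty set, which is [0]. *)
Lemma inverse_process_ltP t s w : inverse_process sigma t w < s ->
  (exists2 y, 0 < y < s & t < sigma y w) \/
  (forall y, 0 < y -> sigma y w <= t).
Proof.
rewrite /inverse_process -/(passage t w).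
have [pE _|ne] := eqVneq (passage t w) set0.
  right=> y y0; rewrite leNgt; apply/negP => ty.
  by have : passage t w y by []; rewrite pE.
move/set0P in ne; move=> /(inf_lt ne)[y [y0 ty] ys].
by left; exists y => //; rewrite y0.
Qed.

(** By monotonicity of paths the event [E t < s] reduces to countably many
    times: either the path exceeds [t] at one of the times [s - 1 / (k + 1)],
    or it never exceeds [t] at an integer time; in the latter case the infimum
    is that of the empty set, which is [0]. *)
Lemma measurable_inverse_process t :
  measurable_fun setT (inverse_process sigma t).
Proof.
apply: (measurability _ (RGenInftyO.measurableE R)) => //.
move=> _ [_ [s ->] <-]; rewrite setTI.
have [s0|s0] := leP s 0.
  rewrite (_ : _ @^-1` _ = set0)//; apply/seteqP; split => w //=.
  by rewrite in_itv/= ltNge (le_trans s0)// inverse_process_ge0.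
pose y (k : nat) : R := s - k.+1%:R^-1.
rewrite (_ : _ @^-1` _ =
    (\bigcup_k (if 0 < y k then [set w | t < sigma (y k) w] else set0)) `|`
    \bigcap_k [set w | sigma k.+1%:R w <= t]).
  apply: measurableU.
    by apply: bigcup_measurable => k _; case: ifP => // _;
      exact: measurable_gt_set.
  apply: bigcap_measurable => // k _.
  exact: measurable_le_set.
apply/seteqP; split => w /=.
  rewrite in_itv/= => /inverse_process_ltP[[z /andP[z0 zs] tz]|h].
    left; have [k zk] := ltr_add_invr zs.
    have zy : z < y k by rewrite /y ltrBrDr.
    exists k => //; rewrite (lt_trans z0 zy)/=.
    exact: (passage_upper z0 tz (ltW zy)).
  by right=> k _; exact: h.
rewrite in_itv/= => -[[k _]|h].
  case: ifPn => // y0 /= ty; apply: (le_lt_trans (inverse_process_le y0 ty)).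
  by rewrite /y gtrBl invr_gt0.
rewrite /inverse_process -/(passage t w) (_ : passage t w = set0) ?inf0//.
rewrite -subset0 => z [z0 tz]; have := h (Num.bound z) I.
rewrite /= leNgt => /negP; apply.
apply: (passage_upper z0 tz); apply: ltW.
by rewrite (lt_le_trans (archi_boundP (ltW z0)))// ler_nat.
Qed.

End inverse_of_subordinator.

(** * Law of the inverse stable subordinator *)

Lemma le0_expRN (R : realType) (p c : R) :
  (forall x, 0 < x -> p <= c * expR (- x)) -> p <= 0.
Proof.
move=> h; rewrite leNgt; apply/negP => p0.
have c0 : 0 < c.
  by have := lt_le_trans p0 (h 1 ltr01); rewrite pmulr_lgt0// expR_gt0.
have cp : 0 < c / p by rewrite divr_gt0.
have := h _ cp; rewrite expRN ler_pdivlMr ?expR_gt0//.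
apply/negP; rewrite -ltNge.
apply: (@lt_le_trans _ _ (p * (1 + c / p))).
  by rewrite mulrDr mulrCA mulfV ?gt_eqF// !mulr1 ltrDr.
by rewrite ler_pM2l// expR_ge1Dx.
Qed.

Section stable_subordinator.
Context (R : realType) (d : measure_display) (T : measurableType d).
Variables (P : probability T R) (alpha : R) (sigma : R -> {RV P >-> R}).
Hypothesis alpha0 : 0 < alpha.
Hypothesis stable_sigma : is_stable_subordinator alpha sigma.

Let sub_sigma : is_subordinator sigma := proj1 stable_sigma.

Let null_of_expRN (A : set T) (c : R) : measurable A ->
  (forall x, 0 < x -> (P A <= (c * expR (- x))%:E)%E) -> P A = 0%E.
Proof.
move=> mA h.
have [p pE] : exists p, P A = p%:E.
  by exists (fine (P A)); rewrite fineK// fin_num_measure.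
have p0 : 0 <= p by rewrite -lee_fin -pE.
rewrite pE; congr (_%:E); apply/eqP; rewrite eq_le p0 andbT.
by apply: (@le0_expRN _ _ c) => x /h; rewrite pE lee_fin.
Qed.

(** [P (sigma 1 = 0)] is at most every value [exp (- l ^ alpha)] of the Laplace
    transform. *)
Lemma stable_subordinator_gt0 : P [set w | sigma 1 w <= 0] = 0%E.
Proof.
have mA : measurable [set w | sigma 1 w <= 0] by exact: measurable_le_set.
(* The rate l = x ^ (1 / alpha) gives the bound exp (- x). *)
apply: (@null_of_expRN _ 1) => // x x0.
have := @laplace_markov _ _ _ P (sigma 1) (x `^ alpha^-1) 0.
rewrite mulr0 expR0 (proj2 stable_sigma)// ?powR_ge0//.
rewrite -powRrM mulVf ?gt_eqF// powRr1 ?(ltW x0)// mul1r -EFinM.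
by apply => //; exact: powR_ge0.
Qed.

(** A version of [sigma 1] that is positive everywhere, which makes its real
    powers meaningful without exceptional sets. *)
Definition positive_time1 (w : T) : R := if 0 < sigma 1 w then sigma 1 w else 1.

Lemma positive_time1_gt0 w : 0 < positive_time1 w.
Proof. by rewrite /positive_time1; case: ifPn. Qed.

Lemma measurable_positive_time1 : measurable_fun setT positive_time1.
Proof.
by apply: measurable_fun_ifT => //; exact: measurable_fun_ltr.
Qed.

Lemma laplace_positive_time1 (l : R) : 0 <= l ->
  ('E_P[fun w => expR (- (l * positive_time1 w))] =
   (expR (- (l `^ alpha)))%:E)%E.
Proof.
move=> l0; rewrite -[X in expR (- X)]mul1r -(proj2 stable_sigma 1 l)//.
rewrite unlock; apply: ae_eq_integral => //.
- by apply/measurable_EFinP; apply: measurable_expRN;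
    exact: measurable_positive_time1.
- by apply/measurable_EFinP; exact: measurable_expRN.
- exists [set w | sigma 1 w <= 0]; split.
  + exact: measurable_le_set.
  + exact: stable_subordinator_gt0.
  + move=> w /=; rewrite leNgt => h; apply/negP => s1; apply: h => _.
    by rewrite /positive_time1 s1.
Qed.

(** Self-similarity: both variables have Laplace transform
    [exp (- s l ^ alpha)]. *)
Lemma stable_scaling (s c : R) : 0 < s -> 0 < c ->
  P [set w | c < sigma s w] =
  P [set w | c < s `^ alpha^-1 * positive_time1 w].
Proof.
move=> s0 c0; have mS := measurable_positive_time1.
apply: (@laplace_tail_unique _ _ _ _ _ _ _ _ _
  (fun l => expR (- (s * l `^ alpha)))) => //.
- by move=> w; apply: subordinator_ge0 => //; exact: ltW.
- by move=> l l0; apply: (proj2 stable_sigma) => //; exact: ltW.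
- exact: measurable_funM.
- by move=> w; rewrite mulr_ge0 ?powR_ge0// ltW// positive_time1_gt0.
- move=> l l0; under eq_fun do rewrite mulrA.
  rewrite laplace_positive_time1 ?mulr_ge0 ?powR_ge0//.
  rewrite powRM ?powR_ge0// -powRrM mulVf ?gt_eqF// powRr1 1?ltW//.
  by rewrite (mulrC s).
Qed.

(** The event that the path never exceeds [t], where the inverse process takes
    its default value, is negligible since [P (sigma n <= t) <= exp (t - n)]. *)
Lemma stable_subordinator_unbounded t :
  P (\bigcap_k [set w | sigma k.+1%:R w <= t]) = 0%E.
Proof.
have mA : measurable (\bigcap_k [set w | sigma k.+1%:R w <= t]).
  by apply: bigcap_measurable => // k _; exact: measurable_le_set.
apply: (@null_of_expRN _ (expR t)) => // x x0.
pose n := (Num.bound x).+1.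
apply: (@le_trans _ _ (P [set w | sigma n%:R w <= t])).
  apply: le_measure; rewrite ?inE//; first exact: measurable_le_set.
  by move=> w; exact.
have := @laplace_markov _ _ _ P (sigma n%:R) 1 t.
rewrite (proj2 stable_sigma)// powR1 mulr1 mul1r -EFinM => h.
apply: (le_trans (h _ _)) => //.
rewrite lee_fin ler_pM2l ?expR_gt0// ler_expR lerN2 ltW//.
by rewrite (lt_trans (archi_boundP (ltW x0)))// ltr_nat.
Qed.

(** A variable with the law of [E 1], as [P (E 1 < s) = P (1 < sigma s)]
    up to boundary terms and [sigma s] is [s ^ (1 / alpha) * sigma 1] in law. *)
Definition unit_inverse (w : T) : R := positive_time1 w `^ (- alpha).

Lemma unit_inverse_gt0 w : 0 < unit_inverse w.
Proof. by rewrite powR_gt0// positive_time1_gt0. Qed.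

Lemma measurable_unit_inverse : measurable_fun setT unit_inverse.
Proof.
exact: (measurableT_comp (measurable_powR (- alpha)) measurable_positive_time1).
Qed.

Lemma unit_inverse_lt (r t : R) w : 0 < r -> 0 < t ->
  (t `^ alpha * unit_inverse w < r) = (t < r `^ alpha^-1 * positive_time1 w).
Proof.
move=> r0 t0; have p0 := positive_time1_gt0 w.
rewrite /unit_inverse powRN ltr_pdivrMr ?powR_gt0//.
have rE : r = (r `^ alpha^-1) `^ alpha.
  by rewrite -powRrM mulVf ?gt_eqF// powRr1// ltW.
rewrite [in LHS]rE -powRM ?powR_ge0 ?(ltW p0)//.
apply/idP/idP; last first.
  apply: gt0_ltr_powR; rewrite // nnegrE ?(ltW t0)//.
  by rewrite mulr_ge0 ?powR_ge0// ltW.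
rewrite !ltNge; apply: contra => h.
apply: ge0_ler_powR => //; rewrite ?nnegrE ?(ltW t0) ?(ltW alpha0)//.
by rewrite mulr_ge0 ?powR_ge0// ltW.
Qed.

(** The two processes are dual: [r < E t] forces [sigma r <= t], which in turn
    forces [r <= E t] off a null set.  By self-similarity [P (sigma r <= t)] is
    [P (r <= t ^ alpha * Y)], so the tails of [E t] and [t ^ alpha * Y] are
    interlaced, hence equal. *)
Lemma ccdf_inverse_process (t s : R) : 0 < t ->
  P [set w | s < inverse_process sigma t w] =
  P [set w | s < t `^ alpha * unit_inverse w].
Proof.
move=> t0.
have mE := measurable_inverse_process sub_sigma t.
have mZ : measurable_fun setT (fun w => t `^ alpha * unit_inverse w).
  by apply: measurable_funM => //; exact: measurable_unit_inverse.
have E0 := inverse_process_ge0 sigma t.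
have Z0 w : 0 <= t `^ alpha * unit_inverse w.
  by rewrite mulr_ge0 ?powR_ge0// ltW// unit_inverse_gt0.
have [s0|s0] := ltP s 0.
  congr (P _); apply/seteqP; split => w _ /=.
    exact: lt_le_trans (Z0 w).
  exact: lt_le_trans (E0 w).
pose E : {RV P >-> R} := mfun_Sub (mem_set mE).
pose Z : {RV P >-> R} := mfun_Sub (mem_set mZ).
have sigma_Z r : 0 < r -> P [set w | sigma r w <= t] = P [set w | r <= Z w].
  move=> r0.
  have -> : [set w | sigma r w <= t] = ~` [set w | t < sigma r w].
    by apply/seteqP; split => w /=; rewrite leNgt => /negP.
  have -> : [set w | r <= Z w] =
      ~` [set w | t < r `^ alpha^-1 * positive_time1 w].
    by apply/seteqP; split => w /=; rewrite -unit_inverse_lt// leNgt => /negP.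
  have mr : measurable_fun setT (fun w => r `^ alpha^-1 * positive_time1 w).
    by apply: measurable_funM => //; exact: measurable_positive_time1.
  rewrite !probability_setC ?stable_scaling//; exact: measurable_gt_set.
have Z_E r : 0 < r -> (P [set w | (r <= Z w)%R] <= P [set w | (r <= E w)%R])%E.
  move=> r0; rewrite -sigma_Z//.
  have mN : measurable (\bigcap_k [set w | sigma k.+1%:R w <= t]).
    by apply: bigcap_measurable => // k _; exact: measurable_le_set.
  have mrE := measurable_ge_set r mE.
  rewrite -[leRHS]adde0 -[X in (_ + X)%E](stable_subordinator_unbounded t).
  apply: le_trans (measureU2 _ mrE mN).
  apply: le_measure; rewrite ?inE//; first exact: measurable_le_set.
    exact: measurableU.
  move=> w /= rt; have [rE|Er] := leP r (E w); [by left|right].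
  have [[y /andP[y0 yr] ty]|h] := inverse_process_ltP Er.
    by have := passage_upper sub_sigma y0 ty (ltW yr); rewrite ltNge rt.
  by move=> k _; exact: h.
have E_Z r : 0 < r -> (P [set w | (r < E w)%R] <= P [set w | (r <= Z w)%R])%E.
  move=> r0; rewrite -sigma_Z//.
  apply: le_measure; rewrite ?inE//.
  - exact: measurable_gt_set.
  - exact: measurable_le_set.
  move=> w /=; rewrite !leNgt => rE; apply/negP => tr.
  by have := inverse_process_le r0 tr; rewrite leNgt rE.
rewrite -(ccdfE E) -(ccdfE Z).
have lt_P (X : {RV P >-> R}) r : s < r ->
    (P [set w | (r <= X w)%R] <= P [set w | (s < X w)%R])%E.
  move=> sr; apply: le_measure; rewrite ?inE//.
  - exact: measurable_ge_set.
  - exact: measurable_gt_set.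
  by move=> w /=; exact: lt_le_trans.
apply/eqP; rewrite eq_le; apply/andP; split.
  apply: ccdf_le_gt => r sr; have r0 := le_lt_trans s0 sr.
  by rewrite !ccdfE (le_trans (E_Z r r0))// lt_P.
apply: ccdf_le_gt => r sr; have r0 := le_lt_trans s0 sr.
rewrite !ccdfE (le_trans _ (lt_P E r sr))// (le_trans _ (Z_E r r0))//.
apply: le_measure; rewrite ?inE//.
- exact: measurable_gt_set.
- exact: measurable_ge_set.
by move=> w /=; exact: ltW.
Qed.
End stable_subordinator.

(** * Growth bounds from the derivative *)

(** Both [g - f] and [g + f] are nondecreasing. *)
Lemma le_increment_derive1 (R : realType) (f g : R -> R) (x y : R) :
  (forall z, 0 < z -> derivable f z 1) ->
  (forall z, 0 < z -> derivable g z 1) ->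
  (forall z, 0 < z -> `|derive1 f z| <= derive1 g z) ->
  0 < x -> x <= y -> `|f y - f x| <= g y - g x.
Proof.
move=> df dg fg x0 xy.
have mono (h : R -> R) : (forall z, 0 < z -> derivable h z 1) ->
    (forall z, 0 < z -> 0 <= derive1 h z) -> h x <= h y.
  move=> dh h0; apply: (@ger0_derive1_le_oo _ h 0 (y + 1)) => //.
  - by move=> z; rewrite in_itv/= => /andP[/dh].
  - by move=> z; rewrite in_itv/= => /andP[/h0].
  - move=> z; rewrite inE/= in_itv/= => /andP[z0 _].
    exact/differentiable_continuous/derivable1_diffP/dh.
  - by rewrite in_itv/= x0/=; lra.
  - by rewrite in_itv/= (lt_le_trans x0)//=; lra.
have h1 : (g - f) x <= (g - f) y.
  apply: mono => z z0; first exact: derivableB (dg z z0) (df z z0).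
  rewrite derive1E deriveB; [|exact: dg|exact: df].
  rewrite -!derive1E subr_ge0.
  by rewrite (le_trans (ler_norm _)) ?fg.
have h2 : (g + f) x <= (g + f) y.
  apply: mono => z z0; first exact: derivableD (dg z z0) (df z z0).
  rewrite derive1E deriveD; [|exact: dg|exact: df].
  rewrite -!derive1E.
  by have := fg z z0; rewrite ler_norml; lra.
have h1' : g x - f x <= g y - f y := h1.
have h2' : g x + f x <= g y + f y := h2.
by rewrite ler_norml; apply/andP; split; lra.
Qed.

Lemma powR_le_sum (R : realType) (z a b c : R) : 0 < z -> a <= b <= c ->
  z `^ b <= z `^ a + z `^ c.
Proof.
move=> z0 /andP[ab bc]; have [z1|z1] := leP 1 z.
  by rewrite (le_trans (ler_powR z1 bc))// lerDr powR_ge0.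
have z01 : 0 < z <= 1 by rewrite z0 ltW.
by rewrite (le_trans (ger_powR z01 ab))// lerDl powR_ge0.
Qed.

(** Exponents larger than [-1] are those for which the moments of the law of
    [E 1] are finite; two of them are needed to control the behaviour near [0]
    and near infinity separately. *)
Definition moderate_growth (R : realType) (h : R -> R) : Prop :=
  exists A r1 r2 : R, [/\ 0 <= A, -1 < r1, -1 < r2 &
    forall z, 0 < z -> `|h z| <= A * (1 + (z `^ r1 + z `^ r2))].

(** Enlarging the bound on [v'] to a sum of two powers, with exponents on either
    side of [-1], avoids the logarithm that integration would produce for
    [beta = 1]. *)
Lemma moderate_growth_derive1 (R : realType) (v : R -> R) (C beta : R) :
  (forall z, 0 < z -> derivable v z 1) -> beta < 2 -> 0 < C ->
  (forall z, 0 < z -> `|derive1 v z| <= C * z `^ (- beta)) ->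
  moderate_growth v.
Proof.
move=> dv b2 C0 vC.
pose b1 := Num.min beta 0; pose b3 := Num.max beta (3 / 2).
have b1b : b1 <= beta by rewrite /b1 ge_min lexx.
have bb3 : beta <= b3 by rewrite /b3 le_max lexx.
pose r1 := 1 - b1; pose r2 := 1 - b3.
have r1_gt0 : 0 < r1.
  by rewrite /r1 subr_gt0 /b1 gt_min ltr01 orbT.
have r2_lt0 : r2 < 0.
  by rewrite /r2 subr_lt0 /b3 lt_max; apply/orP; right; lra.
have r2_gtN1 : -1 < r2.
  suff : b3 < 2 by rewrite /r2; lra.
  by rewrite /b3 gt_max b2/=; lra.
pose k1 := C / r1; pose k2 := C / r2.
(* A primitive of the bound C (z ^ (- b1) + z ^ (- b3)) of |v'|. *)
pose g z := k1 * z `^ r1 + k2 * z `^ r2.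
have r1k : k1 * r1 = C by rewrite /k1 divfK// gt_eqF.
have r2k : k2 * r2 = C by rewrite /k2 divfK// lt_eqF.
have isg (z : R) : 0 < z ->
    is_derive z (1 : R) g (C * (z `^ (- b1) + z `^ (- b3))).
  move=> z0.
  have := is_deriveD (is_deriveZ k1 (is_derive1_powR r1 z0))
    (is_deriveZ k2 (is_derive1_powR r2 z0)).
  move=> /is_derive_eq; apply.
  have -> : r1 - 1 = - b1 by rewrite /r1; ring.
  have -> : r2 - 1 = - b3 by rewrite /r2; ring.
  by rewrite /GRing.scale/= !mulrA r1k r2k mulrDr.
have dg z : 0 < z -> derivable g z 1 by move=> /isg[].
have vg z : 0 < z -> `|derive1 v z| <= derive1 g z.
  move=> z0; have [_] := isg z z0; rewrite -derive1E => ->.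
  rewrite (le_trans (vC z z0))// ler_pM2l// addrC powR_le_sum//.
  by rewrite !lerN2 bb3 b1b.
have vg1 z : 0 < z -> `|v z - v 1| <= `|g z - g 1|.
  move=> z0; have [z1|z1] := leP z 1.
    rewrite distrC [leRHS]distrC.
    by rewrite (le_trans (le_increment_derive1 dv dg vg z0 z1))// ler_norm.
  rewrite (le_trans (le_increment_derive1 dv dg vg ltr01 (ltW z1)))//.
  exact: ler_norm.
pose A := `|v 1| + `|g 1| + `|k1| + `|k2|.
exists A, r1, r2; split => //; first by rewrite !addr_ge0.
  by rewrite (lt_trans _ r1_gt0)// ltrN10.
move=> z z0.
have z1 := powR_ge0 z r1; have z2 := powR_ge0 z r2.
have gz : `|g z| <= `|k1| * z `^ r1 + `|k2| * z `^ r2.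
  by rewrite (le_trans (ler_normD _ _))// !normrM !(ger0_norm (powR_ge0 _ _)).
have vz : `|v z| <= `|v 1| + `|g z| + `|g 1|.
  rewrite -[v z](subrK (v 1)) (le_trans (ler_normD _ _))// addrC -addrA lerD2l.
  by rewrite (le_trans (vg1 z z0))// ler_normB.
have n1 := normr_ge0 (v 1); have n2 := normr_ge0 (g 1).
have n3 := normr_ge0 k1; have n4 := normr_ge0 k2.
apply: (le_trans vz); rewrite /A; nra.
Qed.

Lemma moderate_growth_mul_derive1 (R : realType) (v : R -> R) (C beta : R) :
  beta < 2 -> 0 < C ->
  (forall z, 0 < z -> `|derive1 v z| <= C * z `^ (- beta)) ->
  moderate_growth (fun z => z * derive1 v z).
Proof.
move=> b2 C0 vC; exists C, (1 - beta), (1 - beta).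
split; [exact: ltW|lra|lra|move=> z z0].
rewrite normrM (gtr0_norm z0) -[leLHS]mulrC.
have -> : z `^ (1 - beta) = z * z `^ (- beta).
  by rewrite powRD ?powRr1 ?(ltW z0)// (gt_eqF z0) implybT.
have := vC z z0; have := powR_ge0 z (- beta).
set p := z `^ _; set q := `|_| => p0 qp.
rewrite mulrC; apply: (@le_trans _ _ (z * (C * p))); first by rewrite ler_pM2l.
rewrite mulrCA ler_pM2l//; have zp : 0 <= z * p by rewrite mulr_ge0// ltW.
lra.
Qed.

(** * Differentiation under the expectation *)

(** A real power is monotone in its base, in a direction that depends on the
    sign of the exponent; the sum covers both cases. *)
Lemma powR_between (R : realType) (c1 c c2 r : R) : 0 < c1 -> c1 <= c <= c2 ->
  c `^ r <= c1 `^ r + c2 `^ r.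
Proof.
move=> c10 /andP[c1c cc2]; have c0 := lt_le_trans c10 c1c.
have c20 := lt_le_trans c0 cc2.
have [r0|r0] := leP 0 r.
  apply: (@le_trans _ _ (c2 `^ r)); last by rewrite lerDr powR_ge0.
  by rewrite ge0_ler_powR// nnegrE ltW.
apply: (@le_trans _ _ (c1 `^ r)); last by rewrite lerDl powR_ge0.
rewrite -(opprK r) powRN [leRHS]powRN lef_pV2 ?posrE ?powR_gt0//.
by rewrite ge0_ler_powR// ?nnegrE ?ltW// oppr_gt0.
Qed.

Section scaled_expectation.
Context (R : realType) (d : measure_display) (T : measurableType d).
Variables (P : probability T R) (Y : T -> R).
Hypotheses (Y0 : forall w, 0 < Y w) (mY : measurable_fun setT Y).
Hypothesis momentY : forall r : R, -1 < r ->
  P.-integrable setT (EFin \o (fun w => Y w `^ r)).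

Section growth.
Variables (h : R -> R) (A r1 r2 : R).
Hypotheses (A0 : 0 <= A) (r1N1 : -1 < r1) (r2N1 : -1 < r2).
Hypothesis growth_h : forall z, 0 < z ->
  `|h z| <= A * (1 + (z `^ r1 + z `^ r2)).
Hypothesis cont_h : forall z, 0 < z -> {for z, continuous h}.

(** A bound of [|h (c * Y)|] that is uniform in [c] between [c1] and [c2]. *)
Definition dominating (c1 c2 : R) (w : T) : R :=
  A * (1 + ((c1 `^ r1 + c2 `^ r1) * Y w `^ r1 +
            (c1 `^ r2 + c2 `^ r2) * Y w `^ r2)).

Lemma dominating_ge0 c1 c2 w : 0 <= dominating c1 c2 w.
Proof. by rewrite /dominating !(mulr_ge0, addr_ge0, powR_ge0). Qed.

Lemma integrable_dominating c1 c2 :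
  P.-integrable setT (EFin \o dominating c1 c2).
Proof.
rewrite /dominating.
have i1 := @integrableZl _ _ _ P setT measurableT (c1 `^ r1 + c2 `^ r1)
  _ (momentY r1N1).
have i2 := @integrableZl _ _ _ P setT measurableT (c1 `^ r2 + c2 `^ r2)
  _ (momentY r2N1).
have i3 := integrableD measurableT i1 i2.
have i4 := @finite_measure_integrable_cst _ _ _ P setT 1 measurableT.
have i5 := @integrableZl _ _ _ P setT measurableT A _
  (integrableD measurableT i4 i3).
by apply: eq_integrable i5.
Qed.

Lemma dominating_ge c1 c c2 w : 0 < c1 -> c1 <= c <= c2 ->
  `|h (c * Y w)| <= dominating c1 c2 w.
Proof.
move=> c10 cc; have c0 : 0 < c.
  by case/andP: cc => c1c _; exact: lt_le_trans c1c.
rewrite (le_trans (growth_h _))// ?mulr_gt0//.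
rewrite /dominating ler_wpM2l// lerD2l.
rewrite !powRM ?(ltW c0) ?(ltW (Y0 w))// lerD// ler_wpM2r ?powR_ge0//.
  exact: powR_between.
exact: powR_between.
Qed.

Lemma measurable_scaled c : 0 < c -> measurable_fun setT (fun w => h (c * Y w)).
Proof.
move=> c0.
have mcY : measurable_fun setT (fun w => c * Y w) by exact: measurable_funM.
apply: (@measurable_comp _ _ _ _ _ _ (`]0, +oo[%classic : set R)
  h setT _ _ _ _ mcY) => //.
- by move=> _ [w _ <-] /=; rewrite in_itv/= andbT mulr_gt0.
- apply: open_continuous_measurable_fun => // z.
  by rewrite inE/= in_itv/= andbT => /cont_h.
Qed.

Lemma integrable_scaled c : 0 < c ->
  P.-integrable setT (EFin \o (fun w => h (c * Y w))).
Proof.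
move=> c0; apply: (le_integrable measurableT _ _ (integrable_dominating c c)).
  by apply/measurable_EFinP; exact: measurable_scaled.
move=> w _; rewrite lee_fin [leRHS]ger0_norm ?dominating_ge0//.
by apply: dominating_ge => //; rewrite !lexx.
Qed.

Variable alpha : R.
Hypothesis alpha0 : 0 < alpha.

Lemma powR_window (t x : R) : 0 < t -> t / 2 < x < 2 * t ->
  (t / 2) `^ alpha <= x `^ alpha <= (2 * t) `^ alpha.
Proof.
move=> t0 /andP[tx xt].
by rewrite !ge0_ler_powR ?nnegrE ?(ltW alpha0)//; lra.
Qed.

Lemma continuous_scaled_expectation (t : R) : 0 < t ->
  {for t, continuous (fun x => \int[P]_w h (x `^ alpha * Y w))}.
Proof.
move=> t0; have c10 : 0 < (t / 2) `^ alpha by rewrite powR_gt0//; lra.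
pose I := `](t / 2), (2 * t)[%classic.
have tI : t \in I by rewrite /I inE/= in_itv/=; lra.
have Igt0 x : I x -> 0 < x by rewrite /I/= in_itv/=; lra.
have := @continuity_under_integral R _ T P (fun x w => h (x `^ alpha * Y w))
  setT measurableT (t / 2) (2 * t) _ _
  (dominating ((t / 2) `^ alpha) ((2 * t) `^ alpha))
  (integrable_dominating _ _) _ t tI.
apply.
- by move=> x /Igt0 x0; apply: integrable_scaled; exact: powR_gt0.
- apply: aeW => w _ x; rewrite inE => /Igt0 x0.
  apply: (@continuous_comp _ _ _ (fun x => x `^ alpha * Y w) h).
    apply: continuousM; last exact: cst_continuous.
    apply: differentiable_continuous; apply/derivable1_diffP.
    by apply: derivable_powR; rewrite in_itv/= andbT.
  by apply: cont_h; rewrite mulr_gt0// powR_gt0.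
- move=> x xI; apply: aeW => w _; apply: dominating_ge => //.
  by apply: powR_window => //; move: xI; rewrite /= in_itv.
Qed.

End growth.

Lemma is_derive_scaled (v : R -> R) (alpha x y : R) : 0 < x -> 0 < y ->
  derivable v (x `^ alpha * y) 1 ->
  is_derive x (1 : R) (fun x => v (x `^ alpha * y))
    (alpha * x^-1 * (x `^ alpha * y * derive1 v (x `^ alpha * y))).
Proof.
move=> x0 y0 dv.
have gE : (fun x => x `^ alpha * y) = y \*: (fun x => x `^ alpha) :> (R -> R).
  by apply/funext => z; rewrite mulrC.
have dg : is_derive x (1 : R) (fun x => x `^ alpha * y)
    (y * (alpha * x `^ (alpha - 1))).
  by rewrite gE; exact: is_deriveZ (is_derive1_powR alpha x0).
have := @is_derive1_comp _ v (fun x => x `^ alpha * y) x _ _ (derivableP dv) dg.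
move=> /is_derive_eq; apply.
have -> : x `^ (alpha - 1) = x `^ alpha * x^-1.
  by rewrite powRB ?powRr1 ?(ltW x0)// (gt_eqF x0) implybT.
by rewrite derive1E; ring.
Qed.

(** On the window from [t / 2] to [2 t] the derivative of the integrand is
    [alpha / x * g (x ^ alpha * Y)] with [g z = z * v' z], which the growth of
    [g] dominates. *)
Lemma derive_scaled_expectation (v : R -> R) (alpha t : R) :
  C1_pos v -> moderate_growth v -> moderate_growth (fun z => z * derive1 v z) ->
  0 < alpha -> 0 < t ->
  derivable (fun x => \int[P]_w v (x `^ alpha * Y w)) t 1 /\
  derive1 (fun x => \int[P]_w v (x `^ alpha * Y w)) t =
  alpha * t^-1 *
    \int[P]_w (t `^ alpha * Y w * derive1 v (t `^ alpha * Y w)).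
Proof.
move=> [dv cdv] [A [r1 [r2 [A0 r1N r2N gv]]]].
move=> [A' [r1' [r2' [A'0 r1'N r2'N gg]]]] alpha0 t0.
pose g z := z * derive1 v z.
have cv z : 0 < z -> {for z, continuous v}.
  by move=> z0; apply/differentiable_continuous/derivable1_diffP/dv.
have cg z : 0 < z -> {for z, continuous g}.
  by move=> z0; apply: continuousM; [exact: cvg_id|exact: cdv].
have c10 : 0 < (t / 2) `^ alpha by rewrite powR_gt0//; lra.
pose f x w := v (x `^ alpha * Y w).
have Igt0 x : `](t / 2), (2 * t)[%classic x -> 0 < x.
  by rewrite /= in_itv/=; lra.
have It : `](t / 2), (2 * t)[%classic t by rewrite /= in_itv/=; lra.
pose D := dominating A' r1' r2' ((t / 2) `^ alpha) ((2 * t) `^ alpha).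
pose k := alpha * (t / 2)^-1.
have k0 : 0 <= k by rewrite mulr_ge0// ?invr_ge0; lra.
pose G w := k * D w.
have D0 w : 0 <= D w by exact: dominating_ge0.
have G0 w : 0 <= G w by rewrite mulr_ge0.
have iD : P.-integrable setT (EFin \o D) by exact: integrable_dominating.
have iG : P.-integrable setT (EFin \o G).
  exact: (@integrableZl _ _ _ P setT measurableT k _ iD).
have isf (x : R) (w : T) : 0 < x -> is_derive x (1 : R) (f ^~ w)
    (alpha * x^-1 * g (x `^ alpha * Y w)).
  move=> x0; apply: is_derive_scaled => //; apply: dv.
  by rewrite mulr_gt0 ?powR_gt0.
have d1f (x : R) (w : T) : 0 < x ->
    partial1of2 f x w = alpha * x^-1 * g (x `^ alpha * Y w).
  by move=> x0; rewrite partial1of2E; have [_ ->] := isf x w x0.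
have intf x : `](t / 2), (2 * t)[%classic x -> P.-integrable setT (EFin \o f x).
  move=> /Igt0 x0; apply: (integrable_scaled A0 r1N r2N gv cv).
  by rewrite powR_gt0.
have df (x : R) (w : T) : `](t / 2), (2 * t)[%classic x -> setT w ->
    derivable (f ^~ w) x 1.
  by move=> /Igt0 x0 _; have [] := isf x w x0.
have Gub (x : R) (w : T) : `](t / 2), (2 * t)[%classic x -> setT w ->
    `|partial1of2 f x w| <= G w.
  move=> Ix _; have x0 := Igt0 _ Ix; rewrite d1f// normrM.
  rewrite ger0_norm; last by rewrite mulr_ge0 ?invr_ge0; lra.
  rewrite ler_pM ?mulr_ge0 ?invr_ge0 ?(ltW alpha0) ?(ltW x0)//.
    rewrite ler_wpM2l ?(ltW alpha0)// lef_pV2 ?posrE//; last lra.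
    by move: Ix; rewrite /= in_itv/=; lra.
  apply: (dominating_ge A'0 gg) => //.
  by apply: powR_window => //; move: Ix; rewrite /= in_itv.
split; first exact: (derivable_under_integral measurableT It intf df G0 iG Gub).
rewrite (differentiation_under_integral measurableT It intf df G0 iG Gub).
under eq_Rintegral do rewrite d1f//.
rewrite RintegralZl//.
by apply: (integrable_scaled A'0 r1'N r2'N gg cg); rewrite powR_gt0.
Qed.

End scaled_expectation.

(** * Derivative of the subordinated function *)

Section subordination_by_scaling.
Context (R : realType) (d : measure_display) (T : measurableType d).
Variables (P : probability T R) (alpha : R) (sigma : R -> {RV P >-> R}).
Hypothesis alpha0 : 0 < alpha.
Hypothesis stable_sigma : is_stable_subordinator alpha sigma.

Let Y := unit_inverse alpha sigma.

Lemma unit_inverse_moment (r : R) : -1 < r ->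
  P.-integrable setT (EFin \o (fun w => Y w `^ r)).
Proof.
move=> r1.
have -> : (fun w => Y w `^ r) =
    (fun w => positive_time1 sigma w `^ (- alpha * r)).
  by apply/funext => w; rewrite powRrM.
apply: (stable_moment alpha0 (measurable_positive_time1 sigma)
  (positive_time1_gt0 sigma) (laplace_positive_time1 alpha0 stable_sigma)).
by rewrite mulNr -mulrN gtr_pMr// ltrNl.
Qed.

(** Equality in law transfers both integrability and the expectation from
    [t ^ alpha * Y], where [Y] does not depend on [t], to [E t]. *)
Lemma subordination_scaled (h : R -> R) (t : R) : 0 < t ->
  (forall z, 0 < z -> {for z, continuous h}) ->
  P.-integrable setT (EFin \o (fun w => h (t `^ alpha * Y w))) ->
  subordinable_at sigma h t /\
  subordination sigma h t = \int[P]_w h (t `^ alpha * Y w).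
Proof.
move=> t0 ch ih.
(* Both variables take values in `[0, +oo[; replacing h by 0 elsewhere makes it
   a Borel function without changing either composition. *)
pose f := h \_ `[0, +oo[%classic.
have fh z : 0 <= z -> f z = h z.
  by move=> z0; rewrite /f patchE ifT// inE/= in_itv/= z0.
have mf : measurable_fun setT f.
  apply/(measurable_restrictT h) => //.
  apply/measurable_fun_itv_obnd_cbndP.
  apply: open_continuous_measurable_fun => //.
  by move=> z; rewrite inE/= in_itv/= andbT; exact: ch.
have mE := measurable_inverse_process (proj1 stable_sigma) t.
have mZ : measurable_fun setT (fun w => t `^ alpha * Y w).
  by apply: measurable_funM => //; exact: measurable_unit_inverse.
pose E : {RV P >-> R} := mfun_Sub (mem_set mE).
pose Z : {RV P >-> R} := mfun_Sub (mem_set mZ).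
have hZ : h \o Z = f \o Z.
  apply/funext => w /=; rewrite fh// mulr_ge0 ?powR_ge0//.
have hE : h \o inverse_process sigma t = f \o E.
  by apply/funext => w /=; rewrite fh// inverse_process_ge0.
have law s : ccdf Z s = ccdf E s.
  by rewrite !ccdfE; apply/esym; exact: ccdf_inverse_process.
have iZ : P.-integrable setT (EFin \o (f \o Z)) by rewrite -hZ.
split.
  by rewrite /subordinable_at hE; exact: (eq_law_integrable law mf iZ).
rewrite /subordination hE -(eq_law_expectation law mf iZ) -hZ.
by rewrite unlock.
Qed.

End subordination_by_scaling.

Unset Implicit Arguments.

Theorem proposition4p6 (R : realType) (d : measure_display)
    (T : measurableType d) (P : probability T R)
    (alpha : R) (halpha : 0 < alpha < 1)
    (sigma : R -> {RV P >-> R}) (hsigma : is_stable_subordinator alpha sigma)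
    (v : R -> R) (hv : C1_pos v)
    (hbound : exists C beta : R,
      [/\ 0 < C, (alpha - 1) / alpha < beta < 2 &
          forall t : R, 0 < t -> `|derive1 v t| <= C * t `^ (- beta)]) :
  [/\ forall t : R, 0 < t ->
        subordinable_at sigma v t /\
        subordinable_at sigma (fun z => z * derive1 v z) t,
      C1_pos (subordination sigma v) &
      forall t : R, 0 < t ->
        derive1 (subordination sigma v) t =
        alpha * t^-1 * subordination sigma (fun z => z * derive1 v z) t].
Proof.
have [alpha0 _] := andP halpha.
have [C [beta [C0 /andP[_ b2] vC]]] := hbound.
have [dv cdv] := hv.
pose g z := z * derive1 v z.
pose Y := unit_inverse alpha sigma.
have cv z : 0 < z -> {for z, continuous v}.
  by move=> z0; apply/differentiable_continuous/derivable1_diffP/dv.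
have cg z : 0 < z -> {for z, continuous g}.
  by move=> z0; apply: continuousM; [exact: cvg_id|exact: cdv].
have gv : moderate_growth v := moderate_growth_derive1 dv b2 C0 vC.
have gg : moderate_growth g := moderate_growth_mul_derive1 b2 C0 vC.
have Y0 := unit_inverse_gt0 alpha sigma.
have mY := measurable_unit_inverse alpha sigma.
have momY := unit_inverse_moment alpha0 hsigma.
have scaled (h : R -> R) (t : R) : moderate_growth h ->
    (forall z, 0 < z -> {for z, continuous h}) -> 0 < t ->
    subordinable_at sigma h t /\
    subordination sigma h t = \int[P]_w h (t `^ alpha * Y w).
  move=> [A [r1 [r2 [A0 r1N r2N gh]]]] ch t0.
  apply: (subordination_scaled alpha0 hsigma) => //.
  by apply: (integrable_scaled Y0 mY momY A0 r1N r2N gh ch); rewrite powR_gt0.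
have near_v (t : R) : 0 < t ->
    \forall x \near t, subordination sigma v x = \int[P]_w v (x `^ alpha * Y w).
  move=> t0; near=> x; apply: (scaled _ _ gv cv _).2.
  by near: x; exact: lt_nbhsr.
have der (t : R) : 0 < t -> derivable (subordination sigma v) t 1 /\
    derive1 (subordination sigma v) t = alpha * t^-1 * subordination sigma g t.
  move=> t0.
  have [dF eF] := derive_scaled_expectation Y0 mY momY hv gv gg alpha0 t0.
  split.
    apply: (near_eq_derivable _ dF); near=> x; apply/esym.
    by near: x; exact: near_v.
  rewrite derive1E (near_eq_derive _ (near_v t t0)) -derive1E eF.
  by rewrite (scaled _ _ gg cg t0).2.
split.
- move=> t t0; split; first by have [] := scaled v t gv cv t0.
  by have [] := scaled g t gg cg t0.
- split=> t t0; first by have [] := der t t0.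
  (* Near t the derivative is a product of continuous functions. *)
  have near_d : \forall x \near t,
      alpha * x^-1 * (\int[P]_w g (x `^ alpha * Y w)) =
      derive1 (subordination sigma v) x.
    near=> x; have x0 : 0 < x by near: x; exact: lt_nbhsr.
    by rewrite (der x x0).2 (scaled _ _ gg cg x0).2.
  apply: (cvg_trans (near_eq_cvg near_d)).
  rewrite -(nbhs_singleton near_d).
  have [A [r1 [r2 [A0 r1N r2N ggr]]]] := gg.
  apply: cvgM; last first.
    exact: (continuous_scaled_expectation Y0 mY momY A0 r1N r2N ggr cg alpha0
      t0).
  apply: cvgM; first exact: cvg_cst.
  by apply: cvgV => //; rewrite gt_eqF.
- by move=> t t0; have [] := der t t0.
Unshelve. all: by end_near. Qed.
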